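(* Let $v_0\in\mathbb{R}$, $D>0$, and let $X$ be a random variable with $\mathbb{P}\{X\in\mathcal{L}(v_0,D)\}=1$, with $D$ the maximal span of $X$, with $\mathbb{E}X$ and $\mathbb{E}X^2$ finite, $\mu=\mathbb{E}X$ and $\sigma^2=\mathbb{E}X^2-(\mathbb{E}X)^2>0$. Let $X_1,X_2,\ldots$ be independent copies of $X$ and $S_n=X_1+\cdots+X_n$, $n\ge 1$. Let $\kappa_n\in\mathcal{L}(nv_0,D)$, $n=1,2,\ldots$, be a sequence of reals such that $$\lim_{n\to\infty}\frac{\kappa_n-n\mu}{\sqrt n}=\kappa$$ for some $\kappa\in\mathbb{R}$. Assume that $$\min\big(\mathbb{P}\{X=v_k\},\,\mathbb{P}\{X=v_{k+1}\}\big)>0\qquad\text{for some }k\in\mathbb{Z},$$ where $v_k=v_0+Dk$. Let $0<c<1$. Then there exists a constant $C_c$ (depending on $c$, on the sequence $\{\kappa_n,n\ge 1\}$ and on the law of $X$, but not on $m,n$) such that for all integers $m,n$ with $1\le m\le cn$, $$\sqrt{nm}\,\Big|\mathbb{P}\{S_n=\kappa_n,\ S_m=\kappa_m\}-\mathbb{P}\{S_n=\kappa_n\}\,\mathbb{P}\{S_m=\kappa_m\}\Big|\ \le\ C_c\,\sqrt{\frac mn}.$$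
   Context: For $v\in\mathbb{R}$ and $D>0$, $\mathcal{L}(v,D)=\{v+Dk: k\in\mathbb{Z}\}$ denotes the lattice; for the fixed $v_0$, write $v_k=v_0+Dk$, $k\in\mathbb{Z}$. $D$ is the maximal span of $X$ if $\mathbb{P}\{X\in\mathcal{L}(v_0,D)\}=1$ and there are no $v'\in\mathbb{R}$ and $D'>D$ with $\mathbb{P}\{X\in\mathcal{L}(v',D')\}=1$. *)

(* Defs.v *)
From HB Require Import structures.
From mathcomp Require Import all_boot all_order all_algebra finmap.
From mathcomp Require Import all_classical all_reals all_analysis.

Set Implicit Arguments.
Unset Strict Implicit.
Unset Printing Implicit Defensive.

Import Order.TTheory GRing.Theory Num.Theory.
Import numFieldNormedType.Exports.

Local Open Scope classical_set_scope.
Local Open Scope ring_scope.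

Definition lattice (R : realType) (v D : R) : set R :=
  [set x | exists k : int, x = v + D * k%:~R].

Definition maximal_span (d : measure_display) (T : measurableType d)
    (R : realType) (P : probability T R) (X : {RV P >-> R}) (v0 D : R) : Prop :=
  P (X @^-1` lattice v0 D) = 1%E /\
  ~ (exists v' D' : R, D < D' /\ P (X @^-1` lattice v' D') = 1%E).

Definition mutually_independent (d : measure_display) (T : measurableType d)
    (R : realType) (P : probability T R) (X : nat -> {RV P >-> R}) : Prop :=
  forall (J : {fset nat}) (B : nat -> set R),
    (forall i, measurable (B i)) ->
    P (\bigcap_(i in [set` J]) (X i @^-1` B i)) =
    (\prod_(i <- J) P (X i @^-1` B i))%E.

(* Equality of laws is required on measurable sets only: the value of a measure
   on a non-measurable set carries no information. *)
Definition same_law (d d' : measure_display) (T : measurableType d)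
    (T' : measurableType d') (R : realType) (P : probability T R)
    (P' : probability T' R) (X : {RV P >-> R}) (Y : {RV P' >-> R}) : Prop :=
  forall B : set R, measurable B -> distribution P X B = distribution P' Y B.

(* The sequence is indexed from 0: [Y i] is the copy X_{i+1}. *)
Definition independent_copies (d d' : measure_display) (T : measurableType d)
    (T' : measurableType d') (R : realType) (P : probability T R)
    (P' : probability T' R) (X : {RV P >-> R}) (Y : nat -> {RV P' >-> R}) : Prop :=
  mutually_independent Y /\ forall i, same_law X (Y i).

(* S_n = X_1 + ... + X_n = Y 0 + ... + Y (n - 1). *)
Definition partial_sum (T : Type) (R : realType) (Y : nat -> T -> R) (n : nat)
    (w : T) : R := \sum_(i < n) Y i w.

(* Main.v *)
Require Import Defs.
From HB Require Import structures.
From mathcomp Require Import all_boot all_order all_algebra finmap.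
From mathcomp Require Import all_classical all_reals all_analysis.
From mathcomp Require Import measurable_realfun.
From mathcomp Require Import ring lra zify.

(** Write p_n for the law of S_n on its lattice, read as a function on the
    integers.  By independence the difference of probabilities factors as
      p_m(x) (p_(n-m)(y) - p_n(x + y)),
    with x and x + y the lattice coordinates of kappa_m and kappa_n, so
    everything follows from three estimates of sizes 1/sqrt m, 1/n, sqrt m:
    - sup p_m <= C / sqrt m;
    - |p_l(z + 1) - p_l(z)| <= C / l for every z (then used with l = n - m, a
      fixed fraction of n);
    - E |S_m - kappa_m| <= C sqrt m.
    Indeed p_n(x + y) is the average of p_(n-m)(y - (S_m - x)) over S_m, so that
    |p_(n-m)(y) - p_n(x + y)| is at most the second bound times the third, and
    the product of the three is C / n, which is the claim.

    The third estimate is the second moment of a centred sum, together with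
    kappa_m - m mu = O(sqrt m).  The first follows from the second
    ([coef_le_of_diff]): a function with small increments that is large at one
    point is large nearby, and the total mass is 1.  The second is the heart of
    the matter ([coin_mixture_diff]).  Two neighbouring atoms of mass at least p
    let us write the law of a step as theta U + (1 - theta) V with theta = 2 p
    and U uniform on the two atoms; S_n then contains a random number i of fair
    coins, about theta n of them, and the increments of the binomial law of i
    coins are O(1/i), because they are 2 / (i + 1) times b |i + 1 - 2 z| for a
    weight b of the binomial law of i + 1 coins, and unimodality makes b times its distance to the centre
    at most a constant.  Rather than expanding over the number of coins, an
    induction on n carries the bound 4 / (i + theta n / 2 + 1) for n steps plus
    i coins; halving theta is exactly what absorbs the convexity of 1/x.

    To keep all sums finite, laws are truncated to a window of 2 r + 1 lattice
    points.  A truncated law is a polynomial with nonnegative coefficients,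
    convolution is multiplication of polynomials, and moments are values at 1 of
    derivatives.  For fixed m and n the exact probabilities differ from
    coefficients of powers of that polynomial by at most the probability that
    one of the n steps leaves the window ([path_event_approx]), and the window
    is enlarged until this and the bias of the truncated mean are negligible
    ([good_window]); all constants are independent of r. *)

Set Implicit Arguments.
Unset Strict Implicit.
Unset Printing Implicit Defensive.

Import Order.TTheory GRing.Theory Num.Theory.
Import numFieldNormedType.Exports.

Local Open Scope classical_set_scope.
Local Open Scope ring_scope.

(** * Binomial weights times their distance to the centre *)

Lemma leq_bin_succ J x : (x.*2 < J)%N -> ('C(J, x) <= 'C(J, x.+1))%N.
Proof.
move=> hx; rewrite -(leq_pmul2l (ltn0Sn x)) mul_bin_left leq_mul2r.
by apply/orP; right; lia.
Qed.

Lemma leq_bin_to_centre J x y : (x <= y)%N -> (y.*2 <= J.+1)%N ->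
  ('C(J, x) <= 'C(J, y))%N.
Proof.
elim: y => [|y IHy]; first by rewrite leqn0 => /eqP ->.
rewrite leq_eqVlt => /orP[/eqP -> // | xy] hy.
by apply: leq_trans (IHy _ _) (leq_bin_succ _); lia.
Qed.

(** All binomial coefficients between column x and the middle column are at least
    the one in column x, and there are at least (J - 2 x) / 2 of them; their sum
    is at most 2 ^ J. *)
Lemma bin_mul_dist_centre_left J x : (x.*2 <= J)%N ->
  ('C(J, x) * (J - x.*2) <= 2 * 2 ^ J)%N.
Proof.
move=> hx; have -> : (2 ^ J = \sum_(0 <= y < J.+1) 'C(J, y))%N.
  rewrite -[2%N]/(1 + 1)%N Pascal big_mkord.
  by apply: eq_bigr => i _; rewrite !exp1n !muln1.
pose h := J./2.+1.
have hJ : (h <= J.+1)%N by rewrite /h; lia.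
have -> : (\sum_(0 <= y < J.+1) 'C(J, y) =
   \sum_(0 <= y < x) 'C(J, y) + \sum_(x <= y < h) 'C(J, y)
   + \sum_(h <= y < J.+1) 'C(J, y))%N.
  by rewrite -!big_cat_nat //=; rewrite /h; lia.
have : (\sum_(x <= y < h) 'C(J, x) <= \sum_(x <= y < h) 'C(J, y))%N.
  rewrite !big_nat; apply: leq_sum => y /andP[xy yh].
  by apply: leq_bin_to_centre => //; rewrite /h in yh; lia.
rewrite sum_nat_const_nat => hle.
have h2 : (J - x.*2 <= 2 * (h - x))%N by rewrite /h; lia.
by move: (leq_mul (leqnn 'C(J, x)) h2); lia.
Qed.

Lemma bin_mul_dist_centre (R : realFieldType) J x :
  'C(J, x)%:R * `|J%:R - x.*2%:R| <= 2 * 2 ^+ J :> R.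
Proof.
have hl y : (y.*2 <= J)%N ->
    'C(J, y)%:R * `|J%:R - y.*2%:R| <= 2 * 2 ^+ J :> R.
  move=> hy; rewrite -natrB // normr_nat -natrM -natrX -natrM ler_nat.
  exact: bin_mul_dist_centre_left.
case: (leqP x.*2 J) => [/hl // | hx].
case: (leqP x J) => [xJ | Jx]; last first.
  by rewrite bin_small // mul0r mulr_ge0 // exprn_ge0.
rewrite -bin_sub //.
have -> : J%:R - x.*2%:R = - (J%:R - (J - x).*2%:R) :> R.
  by rewrite -!muln2 !natrM natrB //; ring.
by rewrite normrN; apply: hl; lia.
Qed.

(** * Finite laws as polynomials: bounds on coefficients *)

Definition coef_bounded (R : numDomainType) (C : R) (p : {poly R}) : Prop :=
  forall x, `|p`_x| <= C.

Definition coef_nneg (R : numDomainType) (p : {poly R}) : Prop :=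
  forall x, 0 <= p`_x.

Lemma horner1_coef (R : comNzRingType) (p : {poly R}) n : (size p <= n)%N ->
  p.[1] = \sum_(j < n) p`_j.
Proof.
move=> hn; rewrite (horner_coef_wide _ hn).
by apply: eq_bigr => j _; rewrite expr1n mulr1.
Qed.

Lemma mul_poly_shifts (R : comNzRingType) (p q : {poly R}) :
  p * q = \sum_(j < size p) p`_j *: ('X^j * q).
Proof.
rewrite -{1}[p]coefK poly_def mulr_suml.
by apply: eq_bigr => j _; rewrite scalerAl.
Qed.

Lemma coef_nnegM (R : numDomainType) (p q : {poly R}) :
  coef_nneg p -> coef_nneg q -> coef_nneg (p * q).
Proof.
by move=> hp hq x; rewrite coefM sumr_ge0 // => j _; rewrite mulr_ge0.
Qed.

Lemma coef_nnegX (R : numDomainType) (p : {poly R}) n :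
  coef_nneg p -> coef_nneg (p ^+ n).
Proof.
move=> hp; elim: n => [|n IHn]; last by rewrite exprS; exact: coef_nnegM.
by move=> x; rewrite expr0 coef1 ler0n.
Qed.

Lemma horner1_nneg (R : numDomainType) (p : {poly R}) :
  coef_nneg p -> 0 <= p.[1].
Proof. by move=> hp; rewrite (horner1_coef (leqnn _)) sumr_ge0. Qed.

Lemma coef_le_horner1 (R : numDomainType) (p : {poly R}) x :
  coef_nneg p -> p`_x <= p.[1].
Proof.
move=> hp; rewrite (@horner1_coef _ p (maxn (size p) x.+1)) ?leq_maxl //.
have hx : (x < maxn (size p) x.+1)%N by rewrite leq_max leqnn orbT.
by rewrite (bigD1 (Ordinal hx)) //= lerDl sumr_ge0.
Qed.

Lemma coef_bounded_shift (R : numDomainType) (C : R) (p : {poly R}) n :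
  0 <= C -> coef_bounded C p -> coef_bounded C ('X^n * p).
Proof. by move=> C0 hp x; rewrite coefXnM; case: ifP; rewrite ?normr0. Qed.

Lemma coef_bounded_comb (R : numDomainType) (w B : nat -> R)
    (q : nat -> {poly R}) n :
  (forall j, 0 <= w j) -> (forall j, coef_bounded (B j) (q j)) ->
  coef_bounded (\sum_(j < n) w j * B j) (\sum_(j < n) w j *: q j).
Proof.
move=> hw hq x; rewrite coef_sum (le_trans (ler_norm_sum _ _ _)) //.
apply: ler_sum => j _; rewrite coefZ normrM ger0_norm //.
by apply: ler_wpM2l; [exact: hw | exact: hq].
Qed.

(** Convolution with a positive measure multiplies the supremum by at most the
    mass: this is what lets the part of a step that is not a coin toss be
    ignored. *)
Lemma coef_bounded_mul (R : numDomainType) (C : R) (p q : {poly R}) :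
  0 <= C -> coef_nneg p -> coef_bounded C q -> coef_bounded (p.[1] * C) (p * q).
Proof.
move=> C0 hp hq; rewrite mul_poly_shifts (horner1_coef (leqnn _)) mulr_suml.
apply: (coef_bounded_comb (w := nth 0 p) (B := fun=> C)
  (q := fun j => 'X^j * q)) => // j.
exact: coef_bounded_shift.
Qed.

(** For a law p, the coefficients of (1 - 'X) * p are its increments, including
    the one at its left end, so bounding them says that p extended by zero is
    Lipschitz; here is the bound at distance |i - j|. *)
Lemma coef_bounded_diffXn (R : numDomainType) (L : R) (p : {poly R}) i j :
  coef_bounded L ((1 - 'X) * p) ->
  coef_bounded (`|i%:R - j%:R| * L) (('X^i - 'X^j) * p).
Proof.
move=> hp; have L0 : 0 <= L := le_trans (normr_ge0 _) (hp 0%N).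
have hd k l : coef_bounded (k%:R * L) (('X^l - 'X^(l + k)) * p).
  elim: k => [|k IHk] x.
    by rewrite addn0 subrr !mul0r coef0 normr0.
  have -> : ('X^l - 'X^(l + k.+1)) * p
      = ('X^l - 'X^(l + k)) * p + 'X^(l + k) * ((1 - 'X) * p).
    by rewrite addnS exprSr; ring.
  rewrite coefD (le_trans (ler_normD _ _)) // -natr1 [_ * L]mulrDl mul1r.
  by apply: lerD; [exact: IHk | exact: coef_bounded_shift].
have [ij|/ltnW ji] := leqP i j => x.
  rewrite distrC -natrB // normr_nat -{1}(subnKC ij); exact: hd.
rewrite -opprB mulNr coefN normrN -natrB // normr_nat -{1}(subnKC ji); exact: hd.
Qed.

(** A law with increments at most L that takes the value v at x is at least
    v - r L on the r points from x on, where its mass is at most 1.  The optimal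
    r is of order L^(-1/2), so increments O(1/n) give values O(1/sqrt n). *)
Lemma coef_le_of_diff (R : realFieldType) (L : R) (p : {poly R}) x r :
  coef_nneg p -> p.[1] <= 1 -> coef_bounded L ((1 - 'X) * p) -> (0 < r)%N ->
  p`_x <= r%:R^-1 + r%:R * L.
Proof.
move=> hp p1 hL r0; have L0 : 0 <= L := le_trans (normr_ge0 _) (hL 0%N).
have r0' : 0 < r%:R :> R by rewrite ltr0n.
have h1 (i : 'I_r) : p`_x <= p`_(i + x) + r%:R * L.
  have := coef_bounded_diffXn i 0 hL (i + x)%N.
  rewrite mulrBl coefB !coefXnM ltnNge leq_addr /= subn0 addKn subr0 normr_nat.
  move=> /ler_normlP[_]; have : i%:R * L <= r%:R * L.
    by rewrite ler_wpM2r // ler_nat ltnW.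
  lra.
have h2 : \sum_(i < r) p`_(i + x) <= 1.
  apply: le_trans p1; rewrite (@horner1_coef _ p (maxn (size p) (x + r))) ?leq_maxl //.
  set M := maxn _ _; rewrite -(big_mkord xpredT (fun j => p`_j)).
  have hM : (x + r <= M)%N by rewrite leq_maxr.
  rewrite (@big_cat_nat _ _ _ x) ?(leq_trans (leq_addr r x)) //=.
  rewrite (@big_cat_nat _ _ _ (x + r) x) ?leq_addr //=.
  have -> : \sum_(x <= i < x + r) p`_i = \sum_(i < r) p`_(i + x).
    by rewrite -{1}[x]add0n big_addn addKn big_mkord.
  rewrite addrCA lerDl addr_ge0 ?sumr_ge0 //.
have h3 : \sum_(i < r) p`_x <= \sum_(i < r) (p`_(i + x) + r%:R * L).
  by apply: ler_sum => i _; exact: h1.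
move: h3; rewrite big_split /= !sumr_const card_ord -[p`_x *+ r]mulr_natl -[(_ * L) *+ r]mulr_natl => h3.
rewrite -(ler_pM2l r0') mulrDr divff ?gt_eqF //; lra.
Qed.

(** The law G * E averages the translates of E under G, so its distance to the
    translate by x is governed by the mean of |x - j| under G; the last term is
    the mass missing from G. *)
Lemma coef_smoothing (R : realFieldType) (L : R) (G E : {poly R}) x y :
  coef_nneg G -> G.[1] <= 1 -> coef_nneg E -> E.[1] <= 1 ->
  coef_bounded L ((1 - 'X) * E) ->
  `|E`_y - (G * E)`_(x + y)|
    <= (\sum_(j < size G) G`_j * `|x%:R - j%:R|) * L + (1 - G.[1]).
Proof.
move=> hG G1 hE E1 hL.
have -> : E`_y - (G * E)`_(x + y) = (\sum_(j < size G) G`_j *: (('X^x - 'X^j) * E)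
    + (1 - G.[1]) *: ('X^x * E))`_(x + y).
  have hx : ('X^x * E)`_(x + y) = E`_y by rewrite coefXnM ltnNge leq_addr addKn.
  rewrite -hx -coefB; congr ((polyseq _)`_ _).
  rewrite (mul_poly_shifts G E).
  rewrite scalerBl scale1r [in RHS](horner1_coef (leqnn _)) scaler_suml.
  rewrite addrCA -sumrB -sumrN; congr (_ + _); apply: eq_bigr => j _.
  by rewrite mulrBl scalerBr addrC addrA addNr add0r.
rewrite coefD (le_trans (ler_normD _ _)) //; apply: lerD.
  rewrite mulr_suml.
  under [X in _ <= X]eq_bigr do rewrite -mulrA.
  exact: (coef_bounded_comb (w := nth 0 G) (B := fun j => `|x%:R - j%:R| * L)
            (q := fun j => ('X^x - 'X^j) * E)
            (size G) hG (fun j => coef_bounded_diffXn x j hL) (x + y)%N).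
rewrite coefZ normrM ger0_norm ?subr_ge0 // ler_piMr ?subr_ge0 //.
apply: coef_bounded_shift => // z; rewrite ger0_norm //.
exact: le_trans (coef_le_horner1 _ _) E1.
Qed.

(** * Mixtures with a fair coin *)

Definition fair_coin (R : fieldType) : {poly R} := 2^-1 *: (1 + 'X).

(** Up to the factor 2 / (i + 1), the increment of the binomial law of i coins at
    x is the binomial weight of i + 1 coins at x times i + 1 - 2 x. *)
Lemma fair_coin_diff (R : realFieldType) i :
  coef_bounded (4 / i.+1%:R) ((1 - 'X) * fair_coin R ^+ i).
Proof.
move=> x; rewrite /fair_coin exprZn -scalerAr coefZ mulrBl mul1r coefB.
rewrite [1 + 'X]addrC.
rewrite -[X in _ - nth 0 (polyseq (X * _)) _]expr1.
have hb y : (('X + 1) ^+ i : {poly R})`_y = 'C(i, y)%:R.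
  rewrite exprD1n coef_sum.
  case: (ltnP y i.+1) => hy.
    rewrite (bigD1 (Ordinal hy)) //= big1 ?addr0 => [|j hj].
      by rewrite coefMn coefXn eqxx.
    rewrite coefMn coefXn; case: eqP => [e|_]; last by rewrite mul0rn.
    by case/eqP: hj; apply/val_inj.
  rewrite bin_small // big1 // => j _; rewrite coefMn coefXn.
  by case: eqP => [e|_]; [have := ltn_ord j; lia | rewrite mul0rn].
rewrite coefXnM !hb.
have i0 : 0 < i.+1%:R :> R by rewrite ltr0n.
have key : i.+1%:R * ('C(i, x)%:R - (if (x < 1)%N then 0 else 'C(i, x - 1)%:R))
    = 'C(i.+1, x)%:R * (i.+1%:R - x.*2%:R) :> R.
  case: x => [|x] /=; first by rewrite !bin0 mul1r !subr0 mulr1.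
  have -> : i.+1%:R * ('C(i, x.+1)%:R - 'C(i, x.+1 - 1)%:R)
      = (i.+1 - x.+1)%:R * 'C(i.+1, x.+1)%:R
        - x.+1%:R * 'C(i.+1, x.+1)%:R :> R.
    rewrite subn1 mulrBr -!natrM; congr (_%:R - _%:R).
      exact: mul_bin_down i.+1 x.+1.
    exact: mul_bin_diag i.+1 x.
  case: (leqP x i) => xi; last by rewrite bin_small ?mulr0 ?mul0r ?subr0 //; lia.
  by rewrite natrB // -!muln2 !natrM; ring.
have := bin_mul_dist_centre R i.+1 x.
rewrite -[X in X * _]ger0_norm ?ler0n // -normrM -key normrM ger0_norm ?ler0n //.
rewrite exprS => h.
have t0 : 0 < 2 ^+ i :> R by rewrite exprn_gt0.
rewrite normrM exprVn ger0_norm ?invr_ge0 ?(ltW t0) //.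
by rewrite ler_pdivlMr // -mulrA ler_pdivrMl //; lra.
Qed.

(** Induction on the number n of steps, for all numbers i of extra coins.  One
    step is a coin with weight theta, which turns (n + 1, i) into (n, i + 1),
    and otherwise a convolution with mass 1 - theta, which turns it into
    (n, i). *)
Lemma coin_mixture_diff (R : realFieldType) (F H : {poly R}) (theta : R) a n i :
  0 <= theta -> coef_nneg H -> H.[1] <= 1 - theta ->
  F = theta *: ('X^a * fair_coin R) + H ->
  coef_bounded (4 / (i%:R + theta / 2 * n%:R + 1))
    ((1 - 'X) * F ^+ n * fair_coin R ^+ i).
Proof.
move=> th0 hH H1 hF; have th1 : theta <= 1.
  by have := horner1_nneg hH; lra.
elim: n i => [|n IHn] i.
  rewrite expr0 mulr1 mulr0 addr0 natr1; exact: fair_coin_diff.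
set U := fair_coin R in hF *; set w := i%:R + theta / 2 * n%:R + 1.
have w1 : 1 <= w by rewrite /w lerDr addr_ge0 ?mulr_ge0 ?invr_ge0.
have w0 : 0 < w by lra.
have -> : (1 - 'X) * F ^+ n.+1 * U ^+ i
    = theta *: ('X^a * ((1 - 'X) * F ^+ n * U ^+ i.+1))
      + H * ((1 - 'X) * F ^+ n * U ^+ i).
  rewrite exprS {1}hF [U ^+ i.+1]exprS -!mul_polyC; ring.
move=> x; rewrite coefD coefZ (le_trans (ler_normD _ _)) //.
have hw : i.+1%:R + theta / 2 * n%:R + 1 = w + 1 by rewrite /w -natr1; ring.
have h1 := coef_bounded_shift a _ (IHn i.+1) x; rewrite hw in h1.
have h2 := coef_bounded_mul _ hH (IHn i) x; rewrite -/w in h2.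
have w40 : 0 <= 4 / w by rewrite divr_ge0 // ltW.
have w41 : 0 <= 4 / (w + 1) by rewrite divr_ge0 //; lra.
have h3 : H.[1] * (4 / w) <= (1 - theta) * (4 / w) by apply: ler_wpM2r.
have -> : i%:R + theta / 2 * n.+1%:R + 1 = w + theta / 2.
  by rewrite /w -natr1; ring.
rewrite normrM (ger0_norm th0).
apply: le_trans (_ : theta * (4 / (w + 1)) + (1 - theta) * (4 / w) <= _).
  by apply: lerD; [apply: ler_wpM2l => //; exact: h1 | exact: le_trans (h2 _) h3].
(* With w >= 1 the average of 1 / (w + 1) and 1 / w with weights theta and
   1 - theta is at most 1 / (w + theta / 2); it may exceed 1 / (w + theta),
   whence the rate theta / 2. *)
have -> : theta * (4 / (w + 1)) + (1 - theta) * (4 / w)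
  = 4 * (w + 1 - theta) / (w * (w + 1)).
  by field; apply/andP; split; lra.
rewrite ler_pdivrMr ?mulr_gt0 //; last by lra.
rewrite mulrAC ler_pdivlMr; last by lra.
nra.
Qed.

(** A step with law F tosses a fair coin between the neighbouring points a and
    a + 1 with probability theta, and otherwise follows H. *)
Definition splits_coin (R : realFieldType) (theta : R) (F : {poly R}) : Prop :=
  exists a H, [/\ coef_nneg H, H.[1] <= 1 - theta &
    F = theta *: ('X^a * fair_coin R) + H].

Lemma splits_coin_law (R : realFieldType) (theta : R) (F : {poly R}) :
  0 <= theta -> splits_coin theta F -> coef_nneg F /\ F.[1] <= 1.
Proof.
move=> th0 [a [H [hH H1 ->]]]; split=> [x|].
  rewrite coefD coefZ addr_ge0 // mulr_ge0 // coefXnM; case: ifP => // _.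
  by rewrite coefZ mulr_ge0 ?invr_ge0 // coefD coef1 coefX addr_ge0 // ler0n.
rewrite !hornerE /= expr1n; lra.
Qed.

Lemma splits_coin_diff (R : realFieldType) (theta : R) (F : {poly R}) n :
  0 < theta -> (0 < n)%N -> splits_coin theta F ->
  coef_bounded (8 / (theta * n%:R)) ((1 - 'X) * F ^+ n).
Proof.
move=> th0 n0 [a [H [hH H1 hF]]] x.
have := coin_mixture_diff n 0 (ltW th0) hH H1 hF x.
rewrite expr0 mulr1 => /le_trans; apply.
have n0' : 0 < n%:R :> R by rewrite ltr0n.
have t0 : 0 < theta * n%:R by rewrite mulr_gt0.
rewrite ler_pdivrMr; last by lra.
rewrite mulrAC ler_pdivlMr //; lra.
Qed.

Lemma sqrt_nat_approx n : exists2 r, (n <= r ^ 2)%N & (r ^ 2 <= 4 * n)%N.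
Proof.
have ex : exists r, (n <= r ^ 2)%N by exists n; case: n => // n; nia.
exists (ex_minn ex); case: ex_minnP => [r hr hmin] //.
case: r hr hmin => [|r] // hr hmin.
have : (r ^ 2 < n)%N by rewrite ltnNge; apply/negP => /hmin; rewrite ltnn.
nia.
Qed.

(** [coef_le_of_diff] with the increments of [splits_coin_diff] and r between
    sqrt n and 2 sqrt n. *)
Lemma splits_coin_sup (R : rcfType) (theta : R) (F : {poly R}) n x :
  0 < theta -> (0 < n)%N -> splits_coin theta F ->
  (F ^+ n)`_x <= (1 + 16 / theta) / Num.sqrt n%:R.
Proof.
move=> th0 n0 hF; have [F0 F1] := splits_coin_law (ltW th0) hF.
have [r nr rn] := sqrt_nat_approx n.
have r0 : (0 < r)%N by case: r nr rn => // ; lia.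
have h1 : (F ^+ n).[1] <= 1 by rewrite horner_exp exprn_ile1 // horner1_nneg.
apply: le_trans (coef_le_of_diff x (coef_nnegX n F0) h1
                  (splits_coin_diff th0 n0 hF) r0) _.
set t := Num.sqrt _; have n0' : 0 < n%:R :> R by rewrite ltr0n.
have t0 : 0 < t by rewrite sqrtr_gt0.
have tt : n%:R = t ^+ 2 by rewrite sqr_sqrtr // ltW.
have r0' : 0 < r%:R :> R by rewrite ltr0n.
have tr : t <= r%:R.
  by rewrite -ler_sqr ?nnegrE ?(ltW t0) ?(ltW r0') // -tt -natrX ler_nat.
have rt : r%:R <= 2 * t.
  rewrite -ler_sqr ?nnegrE ?mulr_ge0 ?(ltW t0) ?(ltW r0') // exprMn -tt -!natrX -natrM ler_nat.
  exact: rn.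
rewrite tt.
have e : (1 + 16 / theta) / t = t^-1 + (2 * t) * (8 / (theta * t ^+ 2)).
  by field; rewrite !gt_eqF.
rewrite e; apply: lerD; first by rewrite lef_pV2.
by rewrite ler_wpM2r // divr_ge0 // mulr_ge0 ?sqr_ge0 ?ltW.
Qed.

(** * Moments *)

Definition moment (R : comNzRingType) (b : R) k (p : {poly R}) : R :=
  \sum_(j < size p) p`_j * (j%:R - b) ^+ k.

Lemma moment_wide (R : comNzRingType) (b : R) k (p : {poly R}) n :
  (size p <= n)%N -> moment b k p = \sum_(j < n) p`_j * (j%:R - b) ^+ k.
Proof.
move=> hn; rewrite /moment (big_ord_widen n (fun j => p`_j * (j%:R - b) ^+ k)) //.
rewrite big_mkcond; apply: eq_bigr => j _; case: ltnP => // hj.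
by rewrite nth_default // mul0r.
Qed.

Lemma momentE (R : comNzRingType) (b : R) (p : {poly R}) :
  let T q := 'X * q^`() in
  [/\ moment b 0 p = p.[1],
      moment b 1 p = (T p).[1] - b * p.[1] &
      moment b 2 p = (T (T p)).[1] - 2 * b * (T p).[1] + b ^+ 2 * p.[1]].
Proof.
move=> T.
have sT (q : {poly R}) : (size q <= size p)%N -> (size (T q) <= size p)%N.
  move=> hq; apply/leq_sizeP => -[|j] hj; rewrite /T coefXM //= coef_deriv.
  by rewrite nth_default ?mul0rn // (leq_trans hq).
have cT (q : {poly R}) j : (T q)`_j = q`_j * j%:R.
  by rewrite /T coefXM; case: j => [|j]; rewrite ?mulr0 //= coef_deriv mulr_natr.
have T1 := horner1_coef (sT p (leqnn _)).
have T2 := horner1_coef (sT (T p) (sT p (leqnn _))).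
have T0 := horner1_coef (leqnn (size p)).
split; rewrite /moment.
- by rewrite T0; apply: eq_bigr => j _; rewrite expr0 mulr1.
- rewrite T1 T0 mulr_sumr -sumrB; apply: eq_bigr => j _.
  by rewrite cT expr1; ring.
- rewrite T2 T1 T0 !mulr_sumr -sumrB -big_split; apply: eq_bigr => j _ /=.
  by rewrite !cT; ring.
Qed.

(** Moments of a sum of two independent variables, centred at the sum of the
    centres, for laws of arbitrary mass. *)
Lemma momentM (R : comNzRingType) (b c : R) (p q : {poly R}) :
  [/\ moment (b + c) 0 (p * q) = moment b 0 p * moment c 0 q,
      moment (b + c) 1 (p * q)
        = moment b 1 p * moment c 0 q + moment b 0 p * moment c 1 q &
      moment (b + c) 2 (p * q) = moment b 2 p * moment c 0 q
        + 2 * (moment b 1 p * moment c 1 q) + moment b 0 p * moment c 2 q].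
Proof.
have [p0 p1 p2] := momentE b p; have [q0 q1 q2] := momentE c q.
have [r0 r1 r2] := momentE (b + c) (p * q).
rewrite {}r0 {}r1 {}r2 {}p0 {}p1 {}p2 {}q0 {}q1 {}q2.
by split; rewrite !(derivM, derivD, derivX, hornerM, hornerD, hornerX, hornerC); ring.
Qed.

Lemma moment2_ge0 (R : realFieldType) (b : R) (p : {poly R}) :
  coef_nneg p -> 0 <= moment b 2 p.
Proof. by move=> hp; rewrite sumr_ge0 // => j _; rewrite mulr_ge0 ?sqr_ge0. Qed.

(** The centre b need not be the mean: truncation leaves a small bias
    [moment b 1 p], whose square is multiplied by m ^ 2 while the variance grows
    like m. *)
Lemma moment2_exp (R : realFieldType) (b V : R) (p : {poly R}) m :
  coef_nneg p -> p.[1] <= 1 -> moment b 2 p <= V ->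
  moment (m%:R * b) 2 (p ^+ m) <= m%:R * V + m%:R ^+ 2 * moment b 1 p ^+ 2.
Proof.
move=> hp p1 hV; set d := moment b 1 p.
have s0 := horner1_nneg hp; have V0 : 0 <= V := le_trans (moment2_ge0 b hp) hV.
(* The cross term of the square of the sum is bounded through the sign and size
   of the first moment times the bias d of a single step. *)
suff : [/\ moment (m%:R * b) 0 (p ^+ m) <= 1,
           0 <= moment (m%:R * b) 1 (p ^+ m) * d <= m%:R * d ^+ 2 &
   moment (m%:R * b) 2 (p ^+ m) <= m%:R * V + m%:R ^+ 2 * d ^+ 2] by case.
have ps m' : 0 <= moment (m'%:R * b) 0 (p ^+ m').
  have [-> _ _] := momentE (m'%:R * b) (p ^+ m').
  by apply/horner1_nneg/coef_nnegX.
elim: m => [|m [I0 /andP[I1 I1'] I2]].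
  rewrite !mul0r expr0n mul0r; have [-> -> ->] := momentE 0 (p ^+ 0).
  rewrite expr0 -polyC1 derivC mulr0 derivC mulr0 !hornerC.
  by split; rewrite ?mul0r; lra.
have -> : m.+1%:R * b = m%:R * b + b by rewrite -natr1 mulrDl mul1r.
rewrite exprSr; have [-> -> ->] := momentM (m%:R * b) b (p ^+ m) p.
have [-> _ _] := momentE b p; rewrite -/d.
have I20 := moment2_ge0 (m%:R * b) (coef_nnegX m hp).
have W0 := moment2_ge0 b hp.
have d0 : 0 <= d ^+ 2 := sqr_ge0 d.
move: (ps m) I0 I1 I1' I2 I20 W0 hV.
move: (moment _ 0 _) (moment _ 1 (p ^+ m)) (moment _ 2 (p ^+ m)) (moment b 2 p).
move=> a0 a1 a2 w a00 a01 a1d a1d' ha2 a20 w0 wV.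
move: (p.[1]) s0 p1 => s s0 s1; rewrite -natr1.
have m0 : 0 <= m%:R :> R := ler0n _ m.
move: (m%:R : R) m0 a1d' ha2 => M M0 a1d' ha2.
have h1 : a0 * s <= 1 by rewrite mulr_ile1.
have h2 : 0 <= a1 * d * s <= a1 * d by rewrite mulr_ge0 // ler_piMr.
have h3 : 0 <= a0 * d ^+ 2 <= d ^+ 2 by rewrite mulr_ge0 // ler_piMl.
have h4 : a2 * s <= a2 by rewrite ler_piMr.
have h5 : a0 * w <= w by rewrite ler_piMl.
split => //; first by apply/andP; split; nra.
by nra.
Qed.

(** * Decorrelation of powers *)

(** The distance to x is at most B t + |u|, where t = sqrt m and u is the
    deviation from m b; both terms are compared with t and u ^ 2 / t, whose mean
    is a second moment. *)
Lemma mean_dist_le (R : rcfType) (b B V : R) (p : {poly R}) m x :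
  (0 < m)%N -> coef_nneg p -> p.[1] <= 1 -> moment b 2 p <= V ->
  m%:R * moment b 1 p ^+ 2 <= 1 -> `|x%:R - m%:R * b| <= B * Num.sqrt m%:R ->
  \sum_(j < size (p ^+ m)) (p ^+ m)`_j * `|x%:R - j%:R|
    <= (V + B ^+ 2 + 2) * Num.sqrt m%:R.
Proof.
move=> m0 hp p1 hV hd hx; set G := p ^+ m; set t := Num.sqrt _ in hx *.
have m0' : 0 < m%:R :> R by rewrite ltr0n.
have t0 : 0 < t by rewrite sqrtr_gt0.
have tt : m%:R = t ^+ 2 by rewrite sqr_sqrtr // ltW.
have hG : coef_nneg G := coef_nnegX m hp.
have G1 : G.[1] <= 1 by rewrite horner_exp exprn_ile1 // horner1_nneg.
have M2 : moment (m%:R * b) 2 G <= m%:R * (V + 1).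
  apply: le_trans (moment2_exp m hp p1 hV) _.
  by rewrite mulrDr lerD2l mulr1 expr2 -mulrA ler_piMr // ltW.
have hpt (j : 'I_(size G)) : G`_j * `|x%:R - j%:R|
    <= G`_j * (j%:R - m%:R * b) ^+ 2 / t + G`_j * (B ^+ 2 * t + t).
  rewrite -[_ / t]mulrA -mulrDr ler_wpM2l //.
  have : `|x%:R - j%:R| <= B * t + `|j%:R - m%:R * b|.
    have -> : x%:R - j%:R = (x%:R - m%:R * b) - (j%:R - m%:R * b) by ring.
    by apply: le_trans (ler_normB _ _) _; rewrite lerD2r.
  move: `|_ - j%:R| => u; rewrite -[(_ - _) ^+ 2]real_normK ?num_real //.
  move: `|_ - m%:R * b| (normr_ge0 (j%:R - m%:R * b)) => v v0 huv.
  rewrite (le_trans huv) // -subr_ge0.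
  have -> : v ^+ 2 / t + (B ^+ 2 * t + t) - (B * t + v)
     = ((v / t - 2^-1) ^+ 2 + (B - 2^-1) ^+ 2 + 2^-1) * t.
    by field; rewrite gt_eqF.
  by apply: mulr_ge0 (ltW t0); rewrite !addr_ge0 ?sqr_ge0 // invr_ge0.
apply: le_trans (ler_sum _ (fun i _ => hpt i)) _.
rewrite big_split /= -!mulr_suml -(horner1_coef (leqnn _)) -/(moment _ 2 G).
have h1 : moment (m%:R * b) 2 G / t <= (V + 1) * t.
  by rewrite ler_pdivrMr // (le_trans M2) // tt mulrC expr2 mulrA.
have h2 : G.[1] * (B ^+ 2 * t + t) <= B ^+ 2 * t + t.
  apply: ler_piMl => //; apply: addr_ge0 (ltW t0).
  exact: mulr_ge0 (sqr_ge0 _) (ltW t0).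
lra.
Qed.

(** The three factors bound sqrt m times the largest value of the law of m steps,
    m ^ (-1/2) times the mean distance of S_m from the target, and m + l times
    the largest increment of the law of the l >= (1 - c) (m + l) other steps. *)
Definition corr_const (R : realFieldType) (theta V B c : R) : R :=
  (1 + 16 / theta) * (V + B ^+ 2 + 2) * (8 / (theta * (1 - c))).

(** The difference is p_m(x) times a smoothing error of p_l under p_m, which
    [coef_smoothing] bounds; the last term is the truncated mass. *)
Lemma power_correlation (R : rcfType) (theta b V B c : R) (F : {poly R})
    m l x y :
  0 < theta -> splits_coin theta F -> c < 1 ->
  (0 < m)%N -> m%:R <= c * (m + l)%:R ->
  moment b 2 F <= V -> m%:R * moment b 1 F ^+ 2 <= 1 ->
  `|x%:R - m%:R * b| <= B * Num.sqrt m%:R ->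
  (m + l)%:R * `|(F ^+ m)`_x * (F ^+ l)`_y - (F ^+ m)`_x * (F ^+ (m + l))`_(x + y)|
    <= corr_const theta V B c + (m + l)%:R * (1 - F.[1] ^+ m).
Proof.
move=> th0 hF c1 m0 mc hV hd hx; have [F0 F1] := splits_coin_law (ltW th0) hF.
have n0 : 0 < (m + l)%:R :> R by rewrite ltr0n addn_gt0 m0.
have lc : (1 - c) * (m + l)%:R <= l%:R by move: mc; rewrite natrD; lra.
have l0' : 0 < l%:R :> R by apply: lt_le_trans lc; rewrite mulr_gt0 // subr_gt0.
have l0 : (0 < l)%N by rewrite -(ltr0n R).
have e1 k : (F ^+ k).[1] <= 1 by rewrite horner_exp exprn_ile1 // horner1_nneg.
have := coef_smoothing x y (coef_nnegX m F0) (e1 m) (coef_nnegX l F0) (e1 l)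
  (splits_coin_diff th0 l0 hF).
have Q0 : 0 <= V + B ^+ 2 + 2.
  by rewrite !addr_ge0 ?sqr_ge0 // (le_trans (moment2_ge0 b F0)).
have hA := mean_dist_le m0 F0 F1 hV hd hx.
have hg := splits_coin_sup x th0 m0 hF.
have hg1 : (F ^+ m)`_x <= 1 := le_trans (coef_le_horner1 x (coef_nnegX m F0)) (e1 m).
have hg0 := coef_nnegX m F0 x.
rewrite -exprD -mulrBr normrM (ger0_norm hg0) horner_exp.
have s1 : 0 <= 1 - F.[1] ^+ m by rewrite subr_ge0 -horner_exp.
have m0' : 0 < m%:R :> R by rewrite ltr0n.
have t0 : 0 < Num.sqrt m%:R :> R by rewrite sqrtr_gt0.
move: hA hg hg1 hg0 s1; rewrite /corr_const.
move: (Num.sqrt _) t0 => t t0.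
move: (\sum_(_ < _) _) => A.
move: ((F ^+ m)`_x) => g; move: (1 - _ ^+ _) => s; move: `|_ - _| => w.
move: (V + B ^+ 2 + 2) Q0 => Q Q0 hA hg hg1 hg0 s0 hw.
have L0 : 0 <= 8 / (theta * l%:R) by rewrite divr_ge0 // mulr_ge0 // ltW.
have h1 : (m + l)%:R * (g * w) <= (m + l)%:R * (g * (Q * t * (8 / (theta * l%:R)))) + (m + l)%:R * s.
  rewrite -mulrDr ler_wpM2l ?(ltW n0) //.
  have h2 : g * w <= g * (A * (8 / (theta * l%:R)) + s) by rewrite ler_wpM2l.
  have h3 : g * (A * (8 / (theta * l%:R))) <= g * (Q * t * (8 / (theta * l%:R))).
    by rewrite ler_wpM2l // ler_wpM2r.
  have h4 : g * s <= s by rewrite ler_piMl.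
  move: h2; rewrite mulrDr; lra.
apply: le_trans h1 _; rewrite lerD2r.
have h5 : g * t <= 1 + 16 / theta by rewrite -ler_pdivlMr.
have h6 : (m + l)%:R / l%:R <= (1 - c)^-1.
  rewrite ler_pdivrMr // mulrC -ler_pdivrMr ?invrK ?invr_gt0 ?subr_gt0 //.
  by rewrite mulrC.
have c1' : 0 < 1 - c by rewrite subr_gt0.
have -> : (m + l)%:R * (g * (Q * t * (8 / (theta * l%:R))))
    = (g * t * Q) * (8 / theta * ((m + l)%:R / l%:R)).
  by field; rewrite !gt_eqF.
have -> : (1 + 16 / theta) * Q * (8 / (theta * (1 - c)))
    = ((1 + 16 / theta) * Q) * (8 / theta * (1 - c)^-1).
  by field; rewrite !gt_eqF.
have th8 : 0 <= 8 / theta by rewrite divr_ge0 // ltW.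
apply: ler_pM.
- by rewrite !mulr_ge0 // (ltW t0).
- exact: mulr_ge0 th8 (divr_ge0 (ltW n0) (ltW l0')).
- exact: ler_wpM2r.
- exact: ler_wpM2l.
Qed.

(** * Independent steps inside a finite set of atoms *)

Definition path_event (T : Type) (R : eqType) (Y : nat -> T -> R) n (I : finType)
    (a : I -> R) (t : {ffun 'I_n -> I}) : set T :=
  [set w | forall i : 'I_n, Y i w = a (t i)].

(** Puts the event in the form in which mutual independence applies: [insub]
    picks the prescribed atom for a step below n, and the default [setT] is never
    met. *)
Lemma path_event_bigcap (T : Type) (R : eqType) (Y : nat -> T -> R) n (I : finType)
    (a : I -> R) (t : {ffun 'I_n -> I}) :
  let B i : set R := if insub i is Some k then [set a (t k)] else setT in
  path_event Y a t
    = \bigcap_(i in [set` [fset val k | k in 'I_n]%fset]) (Y i @^-1` B i).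
Proof.
move=> B; apply/seteqP; split=> w hw.
  move=> i /= /imfsetP[k _ ->]; rewrite /B /= insubT /=; first exact: ltn_ord.
  by move=> hk; rewrite hw; congr (a (t _)); apply/val_inj.
move=> k; have /= := hw (val k) (in_imfset _ _ (_ : k \in 'I_n)).
rewrite /B insubT //= => hk; move/(_ isT) => ->.
by congr (a (t _)); apply/val_inj.
Qed.

Lemma measurable_path_event (d : measure_display) (T : measurableType d)
    (R : realType) (P : probability T R) (Y : nat -> {RV P >-> R}) n
    (I : finType) (a : I -> R) (t : {ffun 'I_n -> I}) :
  measurable (path_event (fun i => Y i : T -> R) a t).
Proof.
rewrite path_event_bigcap; apply: fin_bigcap_measurable => // i _.
by apply: measurable_funPTI; case: insub => [k|]; [exact: measurable_set1|].
Qed.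

Lemma path_event_prob (d : measure_display) (T : measurableType d)
    (R : realType) (P : probability T R) (Y : nat -> {RV P >-> R}) n
    (I : finType) (a w : I -> R) (t : {ffun 'I_n -> I}) :
  mutually_independent Y ->
  (forall i j, P (Y i @^-1` [set a j]) = (w j)%:E) ->
  P (path_event (fun i => Y i : T -> R) a t) = (\prod_(i < n) w (t i))%:E.
Proof.
move=> indY hw; rewrite path_event_bigcap indY; last first.
  by move=> i; case: insub => [k|]; [exact: measurable_set1|].
rewrite big_imfset /=; last by move=> ? ? _ _ /val_inj.
rewrite -prodEFin big_enum /=; apply: eq_bigr => k _.
by rewrite valK hw.
Qed.

Lemma path_event_trivIset (T : Type) (R : eqType) (Y : nat -> T -> R) n
    (I : finType) (a : I -> R) (D : set {ffun 'I_n -> I}) :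
  injective a -> trivIset D (path_event Y a (n := n)).
Proof.
move=> ia t t' _ _ [w [ht ht']]; apply/ffunP => i.
by apply: ia; rewrite -ht -ht'.
Qed.

Lemma path_union_prob (d : measure_display) (T : measurableType d)
    (R : realType) (P : probability T R) (Y : nat -> {RV P >-> R}) n
    (I : finType) (a w : I -> R) (Q : pred {ffun 'I_n -> I}) :
  mutually_independent Y -> injective a ->
  (forall i j, P (Y i @^-1` [set a j]) = (w j)%:E) ->
  P (\bigcup_(t in [set` Q]) path_event (fun i => Y i : T -> R) a t)
    = (\sum_(t | Q t) \prod_(i < n) w (t i))%:E.
Proof.
move=> indY ia hw; rewrite measure_fin_bigcup //; first last.
- by move=> t _; exact: measurable_path_event.
- exact: path_event_trivIset.
rewrite -(@bigfs _ _ _ _ (index_enum _)) ?index_enum_uniq //; last first.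
  by move=> t _; rewrite mem_index_enum.
rewrite -sumEFin; apply: eq_bigr => t _; exact: path_event_prob.
Qed.

(** An event decided by the path as soon as the n steps stay among the atoms is,
    on that good event, a disjoint union of path events.  The good event itself
    has probability (\sum_j w j) ^+ n, so its complement is the error. *)
Lemma path_event_approx (d : measure_display) (T : measurableType d)
    (R : realType) (P : probability T R) (Y : nat -> {RV P >-> R}) n
    (I : finType) (a w : I -> R) (Q : pred {ffun 'I_n -> I}) (A : set T) :
  mutually_independent Y -> injective a ->
  (forall i j, P (Y i @^-1` [set a j]) = (w j)%:E) ->
  measurable A ->
  (forall t x, path_event (fun i => Y i : T -> R) a t x -> (A x <-> Q t)) ->
  `|fine (P A) - \sum_(t | Q t) \prod_(i < n) w (t i)|
     <= 1 - (\sum_j w j) ^+ n.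
Proof.
move=> indY ia hw mA hA.
pose U Q' := \bigcup_(t in [set` Q' : pred {ffun 'I_n -> I}])
  path_event (fun i => Y i : T -> R) a t.
have mU Q' : measurable (U Q').
  by apply: fin_bigcup_measurable => // t _; exact: measurable_path_event.
have PU Q' : P (U Q') = _ := path_union_prob Q' indY ia hw.
have -> : \sum_(t | Q t) \prod_(i < n) w (t i) = fine (P (U Q)) by rewrite PU.
have -> : (\sum_j w j) ^+ n = fine (P (U predT)).
  rewrite PU /=; transitivity (\prod_(i < n) \sum_j w j).
    by rewrite prodr_const card_ord.
  by rewrite bigA_distr_bigA.
have UA : A `&` U predT = U Q.
  apply/seteqP; split=> x.
    by move=> [Ax [t _ ht]]; exists t => //=; exact/(hA _ _ ht).
  by move=> [t Qt ht]; split; [exact/(hA _ _ ht) | exists t].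
have e : P A = (P (U Q) + P (A `\` U predT))%E.
  rewrite -UA -measureU; [|exact: measurableI|exact: measurableD|].
    by rewrite setUIDK.
  by rewrite setDE setIACA setICr setI0.
have f B : measurable B -> P B \is a fin_num by exact: fin_num_measure.
rewrite e fineD ?f //; last exact: measurableD.
rewrite addrAC subrr add0r ger0_norm ?fine_ge0 //.
have -> : 1 - fine (P (U predT)) = fine (P (~` U predT)).
  by rewrite probability_setC // fineB ?f.
apply: fine_le; rewrite ?f //; [exact: measurableD|exact: measurableC|].
apply: le_measure; rewrite ?inE; [exact: measurableD|exact: measurableC|].
by move=> x [].
Qed.

(** Generating function in two variables: the inner 'X counts the first m steps
    and the outer one the last l steps, so one product over all m + l steps
    records both sums. *)
Lemma path_sum_coef (R : comNzRingType) N (w : nat -> R) m l x y :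
  \sum_(t : {ffun 'I_(m + l) -> 'I_N} |
      ((\sum_(i < m) t (lshift l i))%N == x) &&
      ((\sum_(i < l) t (rshift m i))%N == y)) \prod_(i < m + l) w (t i)
  = ((\poly_(j < N) w j) ^+ m)`_x * ((\poly_(j < N) w j) ^+ l)`_y.
Proof.
set F := \poly_(j < N) w j.
pose z (i : 'I_(m + l)) : {poly {poly R}} := if (i < m)%N then 'X%:P else 'X.
pose g (i : 'I_(m + l)) (j : 'I_N) := (w j)%:P%:P * z i ^+ j.
have eF : \prod_i \sum_j g i j = (F ^+ m)%:P * (map_poly polyC F) ^+ l.
  rewrite big_split_ord /=; congr (_ * _).
    rewrite (eq_bigr (fun=> F%:P)) ?prodr_const ?card_ord ?polyC_exp // => i _.
    rewrite /F poly_def rmorph_sum; apply: eq_bigr => j _.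
    by rewrite /g /z /= ltn_ord -mul_polyC rmorphM rmorphXn.
  rewrite (eq_bigr (fun=> map_poly polyC F)) ?prodr_const ?card_ord // => i _.
  rewrite /F poly_def rmorph_sum; apply: eq_bigr => j _.
  by rewrite /g /z /= ltnNge leq_addr /= map_polyZ -mul_polyC map_polyXn.
have : (\prod_i \sum_j g i j)`_y`_x = (F ^+ m)`_x * (F ^+ l)`_y.
  by rewrite eF coefCM -rmorphXn coef_map coefMC.
move=> <-; rewrite bigA_distr_bigA /= !coef_sum big_mkcond /=; apply: eq_bigr => t _.
have -> : \prod_i g i (t i)
    = (\prod_(i < m + l) w (t i))%:P%:P
      * (('X^(\sum_(i < m) t (lshift l i)))%:P * 'X^(\sum_(i < l) t (rshift m i))).
  rewrite /g big_split /= !rmorph_prod; congr (_ * _).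
  rewrite big_split_ord /= !expr_sum rmorph_prod; congr (_ * _).
    by apply: eq_bigr => i _; rewrite /z /= ltn_ord rmorphXn.
  by apply: eq_bigr => i _; rewrite /z /= ltnNge leq_addr.
rewrite !coefCM coefXn.
rewrite [y == _]eq_sym.
case: (_ == y); rewrite ?andbF ?mulr0 ?coef0 ?mulr0 //.
by rewrite andbT mulr1 coefXn [x == _]eq_sym; case: (_ == x); rewrite ?mulr1 ?mulr0.
Qed.

Lemma measurable_partial_sum_eq (d : measure_display) (T : measurableType d)
    (R : realType) (P : probability T R) (Y : nat -> {RV P >-> R}) n (z : R) :
  measurable [set v | partial_sum (fun i => Y i : T -> R) n v = z].
Proof.
rewrite -[X in measurable X]setTI -[X in _ `&` X]/(_ @^-1` [set z]).
by apply: measurable_sum.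
Qed.

(** The window consists of the points u + D j with j < N, so after m steps the
    coordinate x is counted from m u. *)
Lemma joint_prob_approx (d : measure_display) (T : measurableType d)
    (R : realType) (P : probability T R) (Y : nat -> {RV P >-> R})
    (u D : R) (w : nat -> R) N m l x y :
  0 < D -> mutually_independent Y ->
  (forall i (j : 'I_N), P (Y i @^-1` [set u + D * j%:R]) = (w j)%:E) ->
  `|fine (P [set v |
        partial_sum (fun i => Y i : T -> R) (m + l) v
          = (m + l)%:R * u + D * (x + y)%:R
     /\ partial_sum (fun i => Y i : T -> R) m v = m%:R * u + D * x%:R])
    - ((\poly_(j < N) w j) ^+ m)`_x * ((\poly_(j < N) w j) ^+ l)`_y|
  <= 1 - (\poly_(j < N) w j).[1] ^+ (m + l).
Proof.
move=> D0 indY hw; set F := \poly_(j < N) w j.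
set S := partial_sum _.
have -> : F.[1] = \sum_(j < N) w j.
  rewrite (horner1_coef (size_poly _ _)); apply: eq_bigr => j _.
  by rewrite coef_poly ltn_ord.
rewrite /F -path_sum_coef; pose a (j : 'I_N) := u + D * j%:R.
apply: (@path_event_approx _ _ _ _ Y _ _ a (fun j : 'I_N => w j)) => //.
- move=> i j /addrI /(mulfI (lt0r_neq0 D0)) /eqP.
  by rewrite eqr_nat => /eqP /val_inj.
- by apply: measurableI; exact: measurable_partial_sum_eq.
move=> t v ht.
have hS n (s : 'I_n -> 'I_(m + l)) : \sum_(i < n) a (t (s i))
   = n%:R * u + D * (\sum_(i < n) t (s i))%:R.
  rewrite big_split /= sumr_const card_ord -[_ *+ n]mulr_natl -mulr_sumr.
  by rewrite natr_sum.
have Sm : S m v = m%:R * u + D * (\sum_(i < m) t (lshift l i))%:R.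
  by rewrite -hS /S /partial_sum; apply: eq_bigr => i _; rewrite (ht (lshift l i)).
have Sn : S (m + l)%N v = (m + l)%:R * u
    + D * (\sum_(i < m) t (lshift l i) + \sum_(i < l) t (rshift m i))%:R.
  rewrite /S /partial_sum big_split_ord /=.
  under eq_bigr => i _ do rewrite (ht (lshift l i)).
  under [X in _ + X]eq_bigr => i _ do rewrite (ht (rshift m i)).
  by rewrite !hS !natrD; ring.
rewrite /= Sm Sn.
have hinj (n k : nat) (b : R) : b + D * n%:R = b + D * k%:R -> n = k.
  by move/addrI/(mulfI (lt0r_neq0 D0))/eqP; rewrite eqr_nat => /eqP.
split=> [[/hinj e2 /hinj e1]|/andP[/eqP -> /eqP ->] //].
by apply/andP; split; apply/eqP => //; move: e2; rewrite e1 => /addnI.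
Qed.

Lemma sum_prob_approx (d : measure_display) (T : measurableType d)
    (R : realType) (P : probability T R) (Y : nat -> {RV P >-> R})
    (u D : R) (w : nat -> R) N m x :
  0 < D -> mutually_independent Y ->
  (forall i (j : 'I_N), P (Y i @^-1` [set u + D * j%:R]) = (w j)%:E) ->
  `|fine (P [set v | partial_sum (fun i => Y i : T -> R) m v
        = m%:R * u + D * x%:R]) - ((\poly_(j < N) w j) ^+ m)`_x|
  <= 1 - (\poly_(j < N) w j).[1] ^+ m.
Proof.
move=> D0 indY hw; have := joint_prob_approx m 0 x 0 D0 indY hw.
rewrite expr0 coef1 mulr1 !addn0; congr (`|fine (P _) - _| <= _).
by apply/seteqP; split=> v //= [].
Qed.

(** * Truncation of a lattice law *)

Lemma ae_lattice (d : measure_display) (T : measurableType d)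
    (R : realType) (P : probability T R) (X : {RV P >-> R}) (v D : R) :
  P (X @^-1` lattice v D) = 1%E -> {ae P, forall w, lattice v D (X w)}.
Proof.
move=> hP; have mL : measurable (lattice v D : set R).
  apply: countable_measurable => //.
  rewrite (_ : lattice v D = (fun k : int => v + D * k%:~R) @` setT).
    exact: sub_countable (card_image_le _ _) (countableP _).
  by apply/seteqP; split=> x [k]; [move=> ->; exists k | move=> _ <-; exists k].
have mE : measurable (X @^-1` lattice v D) by rewrite -[X in measurable X]setTI; apply: measurable_funP.
exists (~` (X @^-1` lattice v D)); split => //; first exact: measurableC.
have := probability_setC P mE; by rewrite hP subee.
Qed.

(** The sums are the expectations of g (X) restricted to the windows, which grow
    to the whole lattice; dominated convergence applies. *)
Lemma lattice_sum_cvg (d : measure_display) (T : measurableType d)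
    (R : realType) (P : probability T R) (X : {RV P >-> R}) (v D : R) (g : R -> R) :
  0 < D -> P (X @^-1` lattice v D) = 1%E -> measurable_fun setT g ->
  P.-integrable setT (fun w => (g (X w))%:E) ->
  (\sum_(j < r.*2.+1) pmf X (v - D * r%:R + D * j%:R)
      * g (v - D * r%:R + D * j%:R)) @[r --> \oo]
    --> fine (\int[P]_w (g (X w))%:E)%E.
Proof.
move=> D0 hL mg ig; set a := fun r j : nat => v - D * r%:R + D * j%:R.
have mA r j : measurable (X @^-1` [set a r j]).
  by rewrite -[X in measurable X]setTI; apply: measurable_funP.
pose f r w := (\sum_(j < r.*2.+1) (g (a r j))%:E * (\1_(X @^-1` [set a r j]) w)%:E)%E.
have If r j : P.-integrable setT (fun w => (g (a r j))%:E * (\1_(X @^-1` [set a r j]) w)%:E)%E.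
  by apply: integrableZl => //; exact: integrable_indic.
have ef r : (\int[P]_w f r w = (\sum_(j < r.*2.+1) pmf X (a r j) * g (a r j))%:E)%E.
  rewrite integral_sum // -sumEFin; apply: eq_bigr => j _.
  rewrite integralZl // ?integral_indic // ?setIT; last exact: integrable_indic.
  by rewrite EFinM muleC fineK // fin_num_measure.
have ainj r : injective (a r).
  by move=> i j /addrI /(mulfI (lt0r_neq0 D0)) /eqP; rewrite eqr_nat => /eqP.
have fin r w (j : 'I_r.*2.+1) : X w = a r j -> f r w = (g (X w))%:E.
  move=> e; rewrite /f (bigD1 j) //= big1 => [|i ij].
    by rewrite indicE mem_set //= mule1 adde0 e.
  rewrite indicE memNset ?mule0 //= e => /ainj /esym h.
  by case/eqP: ij; apply/val_inj.
have fout r w : (forall j : 'I_r.*2.+1, X w <> a r j) -> f r w = 0%E.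
  move=> h; rewrite /f big1 // => i _; rewrite indicE memNset ?mule0 //=.
have [_ _ h] : [/\ P.-integrable setT (fun w => (g (X w))%:E),
  [sequence \int[P]_w (`|f r w - (g (X w))%:E|)]_r @ \oo --> 0%E &
  [sequence \int[P]_w (f r w)]_r @ \oo --> \int[P]_w (g (X w))%:E]%E.
  apply: (@dominated_convergence _ _ _ P setT measurableT f
    (fun w => (g (X w))%:E) (fun w => `|(g (X w))%:E|%E)) => //.
  - move=> r; apply: (measurable_int P); exact: integrable_sum.
  - exact: (measurable_int P).
  - apply: filterS (ae_lattice hL) => w [k hk] _.
    apply: cvg_near_cst; near=> r.
    have hr : (`|k| <= r)%N by near: r; exact: nbhs_infty_ge.
    pose i := absz (k + r%:Z).
    have hi : (i < r.*2.+1)%N by rewrite /i; lia.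
    have ei : i%:R = k%:~R + r%:R :> R.
      have : Posz i = k + r%:Z by rewrite /i; lia.
      by move/(congr1 (fun z : int => z%:~R : R)); rewrite rmorphD /=.
    by apply: (fin r w (Ordinal hi)); rewrite hk /a /= ei; ring.
  - exact: integrable_abse.
  - apply: aeW => w r _.
    case: (pselect (exists j : 'I_r.*2.+1, X w = a r j)) => [[j hj]|hj].
      by rewrite (fin _ _ _ hj).
    by rewrite fout ?abse0 ?abse_ge0 // => j e; apply: hj; exists j.
move: h; under eq_fun do rewrite ef.
rewrite -[X in _ --> X -> _]fineK; last exact: integrable_fin_num.
by move/fine_cvg.
Unshelve. all: by end_near.
Qed.

(** The law of X restricted to the points v + D i with |i| <= r, shifted by r so
    that the exponents are nonnegative.  Hence the centre r + (mu - v) / D below,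
    which is the mean of X in these coordinates. *)
Definition window_law (d : measure_display) (T : measurableType d)
    (R : realType) (P : probability T R) (X : {RV P >-> R}) (v D : R) (r : nat)
  : {poly R} := \poly_(j < r.*2.+1) pmf X (v - D * r%:R + D * j%:R).

(** The three moments of a window are all instances of the same convergence: the
    mass tends to 1, the bias to 0, and the variances are bounded because they
    converge. *)
Lemma moment_cvg (d : measure_display) (T : measurableType d)
    (R : realType) (P : probability T R) (X : {RV P >-> R}) (v D mu : R) k :
  0 < D -> P (X @^-1` lattice v D) = 1%E ->
  P.-integrable setT (fun w => (((X w - mu) / D) ^+ k)%:E) ->
  moment (r%:R + (mu - v) / D) k (window_law X v D r) @[r --> \oo]
    --> fine (\int[P]_w (((X w - mu) / D) ^+ k)%:E)%E.
Proof.
move=> D0 hL ig.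
have mg : measurable_fun setT (fun x : R => ((x - mu) / D) ^+ k).
  apply: measurable_funX; apply: measurable_funM => //.
  exact: measurable_funB.
have := lattice_sum_cvg D0 hL mg ig.
set f := (X in X @ _ --> _ -> _); set h := (X in _ -> X @ _ --> _).
suff -> : h = f by []; apply/funext => r; rewrite /h /f.
rewrite (moment_wide _ _ (size_poly _ _)); apply: eq_bigr => j _.
rewrite coef_poly ltn_ord; congr (_ * _ ^+ k).
by field; exact: lt0r_neq0.
Qed.

Lemma window_law_nneg (d : measure_display) (T : measurableType d)
    (R : realType) (P : probability T R) (X : {RV P >-> R}) (v D : R) r :
  coef_nneg (window_law X v D r).
Proof. by move=> x; rewrite coef_poly; case: ifP => // _; exact: pmf_ge0. Qed.

Lemma window_law_le1 (d : measure_display) (T : measurableType d)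
    (R : realType) (P : probability T R) (X : {RV P >-> R}) (v D : R) r :
  0 < D -> (window_law X v D r).[1] <= 1.
Proof.
move=> D0; rewrite (horner1_coef (size_poly _ _)) -lee_fin -sumEFin.
pose A (j : 'I_r.*2.+1) := X @^-1` [set v - D * r%:R + D * j%:R].
have mA j : measurable (A j).
  by rewrite -[X in measurable X]setTI; apply: measurable_funP.
rewrite (eq_bigr (fun j => P (A j))) => [|j _]; last first.
  by rewrite coef_poly ltn_ord fineK // fin_num_measure.
rewrite -(@measure_bigsetU_ord _ _ _ P _ xpredT A) //; first last.
  move=> i j _ _ [w [hi hj]]; have := etrans (esym hi) hj.
  move=> /addrI /(mulfI (lt0r_neq0 D0)) /eqP.
  by rewrite eqr_nat => /eqP /val_inj.
by apply: probability_le1; exact: bigsetU_measurable.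
Qed.

(** The coin sits on the two neighbouring atoms of mass at least p, each of which
    gives up exactly p; the window has to contain both. *)
Lemma window_law_splits_coin (d : measure_display) (T : measurableType d)
    (R : realType) (P : probability T R) (X : {RV P >-> R}) (v D p : R)
    (k : int) r :
  0 < D -> p <= pmf X (v + D * k%:~R) -> p <= pmf X (v + D * (k + 1)%:~R) ->
  (`|k|.+1 <= r)%N -> splits_coin (2 * p) (window_law X v D r).
Proof.
move=> D0 p0 p1 kr; pose a := absz (k + r%:Z).
have ea : Posz a = k + r%:Z by rewrite /a; lia.
have ea' : a%:R = k%:~R + r%:R :> R.
  by move: ea => /(congr1 (fun z : int => z%:~R : R)); rewrite rmorphD.
pose F := window_law X v D r.
pose M := (2 * p) *: ('X^a * fair_coin R).
have cM x : M`_x = p * ((x == a)%:R + (x == a.+1)%:R).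
  have -> : M = p *: ('X^a + 'X^(a.+1)).
    rewrite /M /fair_coin exprSr -!mul_polyC !polyCM.
    have : (2%:P * (2^-1)%:P = 1 :> {poly R}) by rewrite -polyCM divff.
    move: (2%:P) (2^-1)%:P => b c bc.
    transitivity (b * c * (p%:P * ('X^a + 'X^a * 'X))); first by ring.
    by rewrite bc mul1r.
  by rewrite coefZ coefD !coefXn.
exists a, (F - M); split; last by rewrite addrC subrK.
- move=> x; rewrite coefB cM coef_poly.
  have [->|xa] := eqVneq x a.
    rewrite (ltn_eqF (leqnn _)) addr0 mulr1 ifT; last by lia.
    rewrite subr_ge0 (le_trans p0) // ea' (_ : v + _ = v - D * r%:R + D * (k%:~R + r%:R)) //.
    by ring.
  have [->|xa1] := eqVneq x a.+1.
    rewrite add0r mulr1 ifT; last by lia.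
    rewrite subr_ge0 (le_trans p1) // -natr1 ea' rmorphD /=.
    rewrite (_ : v + _ = v - D * r%:R + D * (k%:~R + r%:R + 1)) //.
    by ring.
  rewrite addr0 mulr0 subr0; case: ifP => // _; exact: pmf_ge0.
have -> : (F - M).[1] = F.[1] - 2 * p.
  by rewrite /M /fair_coin !hornerE /= expr1n; field.
by rewrite lerD2r window_law_le1.
Qed.

Lemma copies_pmf (d d' : measure_display) (T : measurableType d)
    (T' : measurableType d') (R : realType) (P : probability T R)
    (P' : probability T' R) (X : {RV P >-> R}) (Y : nat -> {RV P' >-> R}) i x :
  independent_copies X Y -> P' (Y i @^-1` [set x]) = (pmf X x)%:E.
Proof.
move=> [_ /(_ i [set x] (measurable_set1 x))]; rewrite /distribution /pushforward => <-.
by rewrite /pmf fineK // fin_num_measure // -[X in measurable X]setTI; apply: measurable_funP.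
Qed.

Lemma integrable_affine (d : measure_display) (T : measurableType d)
    (R : realType) (P : probability T R) (f : T -> R) (a b : R) :
  P.-integrable setT (fun w => (f w)%:E) ->
  P.-integrable setT (fun w => (a * f w + b)%:E) /\
  (\int[P]_w (a * f w + b)%:E)%E = (a * fine (\int[P]_w (f w)%:E)%E + b)%:E.
Proof.
move=> hf; have ia : P.-integrable setT (fun w => a%:E * (f w)%:E)%E by exact: integrableZl.
have ib : P.-integrable setT (fun _ : T => b%:E) by exact: finite_measure_integrable_cst.
have e w : (a * f w + b)%:E = (a%:E * (f w)%:E + b%:E)%E by rewrite EFinD EFinM.
split; first by under eq_fun do rewrite e; exact: integrableD.
under eq_integral do rewrite e.
rewrite integralD // integralZl // integral_cst //.
rewrite [X in (_ + _ * X)%E](probability_setT P) mule1.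
by rewrite EFinD EFinM fineK // integrable_fin_num.
Qed.

(** V is fixed before m and n, whereas the window may depend on them: the bias
    and the missing mass are multiplied by m and n below. *)
Lemma good_window (d : measure_display) (T : measurableType d)
    (R : realType) (P : probability T R) (X : {RV P >-> R}) (v D mu : R) :
  0 < D -> P (X @^-1` lattice v D) = 1%E ->
  P.-integrable setT (fun w => (X w)%:E) ->
  P.-integrable setT (fun w => (X w ^+ 2)%:E) ->
  mu = fine (\int[P]_w (X w)%:E)%E ->
  exists V : R, forall m n r0 : nat, exists r : nat,
    let F := window_law X v D r in let b := r%:R + (mu - v) / D in
    [/\ (r0 <= r)%N, moment b 2 F <= V, m%:R * moment b 1 F ^+ 2 <= 1 &
        n%:R * (1 - F.[1] ^+ n) <= 1].
Proof.
move=> D0 hL h1 h2 hmu; have Dn0 := lt0r_neq0 D0.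
have i0 : P.-integrable setT (fun w => (((X w - mu) / D) ^+ 0)%:E).
  exact: finite_measure_integrable_cst.
have e1 w : ((X w - mu) / D) ^+ 1 = D^-1 * X w + (- mu / D) by rewrite expr1; field.
have [i1 e] := integrable_affine (D^-1) (- mu / D) h1.
have e2 w : ((((X w - mu) / D) ^+ 2)%:E
    = (D ^- 2 * (X w ^+ 2) + 0)%:E + (- 2 * mu * D ^- 2 * X w + mu ^+ 2 * D ^- 2)%:E)%E.
  by rewrite -EFinD; congr (_%:E); field.
have i2 : P.-integrable setT (fun w => (((X w - mu) / D) ^+ 2)%:E).
  under eq_fun do rewrite e2.
  by apply: integrableD => //; apply: (integrable_affine _ _ _).1.
have c0 := moment_cvg D0 hL i0.
have c2 := moment_cvg D0 hL i2.
have i1' : P.-integrable setT (fun w => (((X w - mu) / D) ^+ 1)%:E).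
  by under eq_fun do rewrite e1.
have := moment_cvg D0 hL i1'; under eq_integral do rewrite e1.
rewrite e /= -hmu [X in _ --> X -> _](_ : _ = 0) => [c1|]; last by field.
have /cvg_seq_bounded [V0 [_ hV0]] : cvgn (fun r : nat =>
    moment (r%:R + (mu - v) / D) 2 (window_law X v D r)) by apply: cvgP c2.
have /hV0 hV : V0 < V0 + 1 by rewrite ltrDl ltr01.
exists (V0 + 1) => m n r0.
have c1m : m%:R * moment (r%:R + (mu - v) / D) 1 (window_law X v D r) ^+ 2
    @[r --> \oo] --> 0.
  have -> : (0 : R) = m%:R * 0 ^+ 2 by rewrite expr0n mulr0.
  apply: cvgM; first exact: cvg_cst.
  exact: cvg_comp c1 (@exprn_continuous _ 2 _).
have c0n : n%:R * (1 - (window_law X v D r).[1] ^+ n) @[r --> \oo] --> 0.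
  have : (window_law X v D r).[1] @[r --> \oo] --> (1 : R).
    move: c0; rewrite (_ : fine _ = 1).
      set f := (X in X @ _ --> _ -> _); set h := (X in _ -> X @ _ --> _).
      suff -> : h = f by [].
      apply/funext => r; rewrite /h /f.
      by have [-> _ _] := momentE (r%:R + (mu - v) / D) (window_law X v D r).
    under eq_integral do rewrite expr0.
    by rewrite integral_cst // [X in (_ * X)%E](probability_setT P) mule1.
  move=> c; have -> : (0 : R) = n%:R * (1 - 1 ^+ n) by rewrite expr1n subrr mulr0.
  apply: cvgM; first exact: cvg_cst.
  apply: cvgB; first exact: cvg_cst.
  exact: cvg_comp c (@exprn_continuous _ n _).
near \oo => r; exists r; split.
- by near: r; exact: nbhs_infty_ge.
- exact: le_trans (ler_norm _) (hV r I).
- near: r; move/cvgr_le : c1m => /(_ 1 ltr01).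
  by apply: filterS => r.
- near: r; move/cvgr_le : c0n => /(_ 1 ltr01).
  by apply: filterS => r.
Unshelve. all: by end_near.
Qed.

(** * The correlation bound *)

(** Transfers the estimate from coefficients to probabilities; h is the
    probability that some step leaves the window. *)
Lemma correlation_approx (R : realDomainType) (A B C g e f h : R) :
  `|A - g * e| <= h -> `|B - f| <= h -> `|C - g| <= h ->
  0 <= B <= 1 -> 0 <= g <= 1 ->
  `|A - B * C| <= `|g * e - g * f| + 3 * h.
Proof.
move=> hA hB hC /andP[B0 B1] /andP[g0 g1].
have -> : A - B * C = (A - g * e) + (g * e - g * f)
   + (- (g * (B - f)) - B * (C - g)) by ring.
have h0 : 0 <= h := le_trans (normr_ge0 _) hA.
have hgB : `|g * (B - f)| <= h.
  by rewrite normrM ger0_norm // (le_trans _ hB) // ler_piMl.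
have hBC : `|B * (C - g)| <= h.
  by rewrite normrM ger0_norm // (le_trans _ hC) // ler_piMl.
have h1 := ler_normD (A - g * e + (g * e - g * f)) (- (g * (B - f)) - B * (C - g)).
have h2 := ler_normD (A - g * e) (g * e - g * f).
have h3 := ler_normB (- (g * (B - f))) (B * (C - g)); rewrite normrN in h3.
lra.
Qed.

Unset Implicit Arguments.

Theorem corollary1p2 (R : realType) (d : measure_display) (T : measurableType d)
    (P : probability T R) (X : {RV P >-> R}) (v0 D mu sigma : R)
    (hD : 0 < D)
    (hlat : P (X @^-1` lattice v0 D) = 1%E)
    (hspan : maximal_span X v0 D)
    (hX1 : P.-integrable [set: T] (fun w => (X w)%:E))
    (hX2 : P.-integrable [set: T] (fun w => (X w ^+ 2)%:E))
    (hmu : mu = fine ('E_P[X])%E)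
    (hsigma : sigma ^+ 2 =
      fine ('E_P[(fun w => (X w ^+ 2)%R)])%E - (fine ('E_P[X])%E) ^+ 2)
    (hsigma0 : 0 < sigma ^+ 2)
    (kappa_ : nat -> R) (kappa : R)
    (hkappa_lat : forall n : nat, (1 <= n)%N -> lattice (n%:R * v0) D (kappa_ n))
    (hkappa_lim :
      ((kappa_ n - n%:R * mu) / Num.sqrt n%:R) @[n --> \oo] --> kappa)
    (hmin : exists k : int,
      0 < Num.min (fine (P [set w | X w = v0 + D * k%:~R]))
                  (fine (P [set w | X w = v0 + D * (k + 1)%:~R])))
    (c : R) (hc0 : 0 < c) (hc1 : c < 1) :
  exists C : R,
    forall (d' : measure_display) (T' : measurableType d')
      (P' : probability T' R) (Y : nat -> {RV P' >-> R}),
    independent_copies X Y ->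
    let S := partial_sum (fun i => Y i : T' -> R) in
    forall m n : nat, (1 <= m)%N -> m%:R <= c * n%:R ->
      Num.sqrt (n%:R * m%:R) *
        `| fine (P' [set w | S n w = kappa_ n /\ S m w = kappa_ m])
           - fine (P' [set w | S n w = kappa_ n])
             * fine (P' [set w | S m w = kappa_ m]) |
      <= C * Num.sqrt (m%:R / n%:R).
Proof.
have Dn0 := lt0r_neq0 hD.
have [k hk] := hmin; set p := Num.min _ _ in hk.
have p0 : p <= pmf X (v0 + D * k%:~R) by rewrite /p ge_min lexx.
have p1 : p <= pmf X (v0 + D * (k + 1)%:~R) by rewrite /p ge_min lexx orbT.
have [V hV] : exists V : R, _ :=
  good_window hD hlat hX1 hX2 (etrans hmu (congr1 fine (expectation_def X))).
have [M hM] : exists M : R, forall n, `|(kappa_ n - n%:R * mu) / Num.sqrt n%:R| <= M.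
  have /cvg_seq_bounded [M0 [_ hM0]] : cvgn (fun n : nat =>
    (kappa_ n - n%:R * mu) / Num.sqrt n%:R) by apply: cvgP hkappa_lim.
  have /hM0 hM : M0 < M0 + 1 by rewrite ltrDl ltr01.
  by exists (M0 + 1) => n; exact: hM.
exists (corr_const (2 * p) V (M / D) c + 1) => d' T' P' Y hY S m n m1 mc.
have m0 : 0 < m%:R :> R by rewrite ltr0n.
have n0 : 0 < n%:R :> R by rewrite -(pmulr_rgt0 _ hc0); exact: lt_le_trans mc.
have mn : (m < n)%N.
  by rewrite -(ltr_nat R) (le_lt_trans mc) // gtr_pMl.
set A := fine _; set B := fine _; set C := fine _.
suff main : n%:R * `|A - B * C| <= corr_const (2 * p) V (M / D) c + 1.
  have -> : Num.sqrt (n%:R * m%:R) = n%:R * Num.sqrt (m%:R / n%:R) :> R.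
    have sn0 : Num.sqrt n%:R != 0 :> R by rewrite sqrtr_eq0 -ltNge.
    rewrite sqrtrM ?(ltW n0) // sqrtrM ?(ltW m0) // sqrtrV ?(ltW n0) // mulrCA.
    by rewrite -{2}(sqr_sqrtr (ltW n0)) expr2 mulfK // mulrC.
  by rewrite mulrAC ler_wpM2r // sqrtr_ge0.
have [km ekm] := hkappa_lat m m1.
have [kn ekn] := hkappa_lat n (leq_ltn_trans (leq0n m) mn).
have [l enl] : exists l, n = (m + l)%N by exists (n - m)%N; rewrite subnKC // ltnW.
have l0 : (0 < l)%N by move: mn; rewrite enl -{1}[m]addn0 ltn_add2l.
(* Four error terms are multiplied by n at the end: three from
   [correlation_approx], one from the mass missing from the law of S_m. *)
have [r] := hV m (4 * n)%N (`|k|.+1 + `|km| + `|kn|)%N.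
set F := window_law X v0 D r; set b := r%:R + _ => -[r0 hV2 hd hs].
have hF : splits_coin (2 * p) F.
  by apply: (window_law_splits_coin hD p0 p1); move: r0; clear; lia.
have F0 : coef_nneg F := window_law_nneg X v0 D r.
have F1 : F.[1] <= 1 := window_law_le1 X v0 r hD.
have s0 : 0 <= F.[1] := horner1_nneg F0.
(* Coordinates of kappa_m and of kappa_n - kappa_m in the shifted window. *)
pose x := absz (km + (m * r)%:Z); pose y := absz (kn - km + (l * r)%:Z).
have ex : Posz x = km + (m * r)%:Z by rewrite /x; move: r0 m1; clear; nia.
have ey : Posz y = kn - km + (l * r)%:Z by rewrite /y; move: r0 l0; clear; nia.
have exR : x%:R = km%:~R + m%:R * r%:R :> R.
  by move: ex => /(congr1 (fun z : int => z%:~R : R)); rewrite rmorphD -natrM.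
have exyR : (x + y)%:R = kn%:~R + n%:R * r%:R :> R.
  have : Posz (x + y) = kn + (n * r)%:Z by move: ex ey enl; clear; nia.
  by move=> /(congr1 (fun z : int => z%:~R : R)); rewrite [X in _ = X -> _]rmorphD -natrM.
pose u := v0 - D * r%:R.
have km' : kappa_ m = m%:R * u + D * x%:R by rewrite ekm exR /u; ring.
have kn' : kappa_ n = n%:R * u + D * (x + y)%:R by rewrite ekn exyR /u; ring.
pose w j := pmf X (u + D * j%:R).
have hw i (j : 'I_r.*2.+1) : P' (Y i @^-1` [set u + D * j%:R]) = (w j)%:E.
  exact: copies_pmf.
have hA := joint_prob_approx (w := w) m l x y hD hY.1 hw.
rewrite -enl -km' -kn' -/F in hA.
have hB := sum_prob_approx (w := w) n (x + y) hD hY.1 hw.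
rewrite -kn' -/F in hB.
have hC := sum_prob_approx (w := w) m x hD hY.1 hw.
rewrite -km' -/F in hC.
have hmn : F.[1] ^+ n <= F.[1] ^+ m by rewrite ler_wiXn2l // ltnW.
have h4n : F.[1] ^+ (4 * n) <= F.[1] ^+ n by rewrite ler_wiXn2l // leq_pmull.
have hC' := le_trans hC (lerB (lexx 1) hmn).
have hx : `|x%:R - m%:R * b| <= M / D * Num.sqrt m%:R.
  have -> : x%:R - m%:R * b = (kappa_ m - m%:R * mu) / Num.sqrt m%:R * (Num.sqrt m%:R / D).
    rewrite km' /b /u; field.
    by rewrite Dn0 sqrtr_eq0 -ltNge.
  have sD : 0 <= Num.sqrt m%:R / D by rewrite divr_ge0 ?sqrtr_ge0 ?ltW.
  rewrite normrM (ger0_norm sD) mulrAC -mulrA.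
  by rewrite ler_wpM2r.
have p20 : 0 < 2 * p by rewrite mulr_gt0.
have mc' : m%:R <= c * (m + l)%:R by rewrite -enl.
have := power_correlation y p20 hF hc1 m1 mc' hV2 hd hx; rewrite -enl => hK.
have g01 : 0 <= (F ^+ m)`_x <= 1.
  rewrite coef_nnegX //= (le_trans (coef_le_horner1 _ (coef_nnegX _ F0))) //.
  by rewrite horner_exp exprn_ile1.
have B01 : 0 <= B <= 1.
  have mB : measurable [set w | S n w = kappa_ n].
    exact: measurable_partial_sum_eq.
  by rewrite fine_ge0 //= -lee_fin fineK ?probability_le1 ?fin_num_measure.
have hABC := correlation_approx hA hB hC' B01 g01.
have := ler_wpM2l (ltW n0) hABC; rewrite mulrDr => /le_trans; apply.
have hnm : n%:R * (1 - F.[1] ^+ m) <= n%:R * (1 - F.[1] ^+ n).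
  by rewrite ler_wpM2l ?(ltW n0) // lerD2l lerN2.
have h4 : n%:R * (1 - F.[1] ^+ n) <= n%:R * (1 - F.[1] ^+ (4 * n)).
  by rewrite ler_wpM2l ?(ltW n0) // lerD2l lerN2.
rewrite natrM in hs; move: hK hnm h4 hs; clear; lra.
Qed.
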